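(* Let $X$ be an arbitrary set. Then: (i) $\mathcal F_X^L = E(\mathcal{PB}_X)\,\mathcal G_X^L = \{\alpha\in\mathcal{PB}_X : \operatorname{codef}(\alpha)\leq\operatorname{def}(\alpha)\}$; (ii) $\mathcal F_X^R = \mathcal G_X^R\, E(\mathcal{PB}_X) = \{\alpha\in\mathcal{PB}_X : \operatorname{def}(\alpha)\leq\operatorname{codef}(\alpha)\}$.
   Context: Partial Brauer monoid. Let $X$ be a set and $X'=\{x':x\in X\}$ a disjoint copy of $X$. A Brauer graph is an (undirected) graph with vertex set $X\cup X'$ in which every vertex has degree at most $1$; $\mathcal{PB}_X$ is the set of all of them. Product: let $X''=\{x'':x\in X\}$ be another disjoint copy of $X$; given $\alpha,\beta\in\mathcal{PB}_X$, let $\alpha^\vee$ be $\alpha$ with each vertex $x'$ renamed $x''$, let $\beta^\wedge$ be $\beta$ with each vertex $x\in X$ renamed $x''$, and let $\Pi(\alpha,\beta)$ be the graph on $X\cup X'\cup X''$ with all edges of $\alpha^\vee$ and $\beta^\wedge$. Then $\alpha\beta$ is the graph on $X\cup X'$ with an edge $\{x,y\}$ whenever $x,y\in X\cup X'$ are distinct and lie in the same connected component of $\Pi(\alpha,\beta)$. This makes $\mathcal{PB}_X$ a monoid with identity the graph with edge set $\{\{x,x'\}:x\in X\}$. A transversal of $\alpha$ is an edge $\{x,y'\}$ with $x,y\in X$ (possibly $x=y$). $\operatorname{Dom}(\alpha)$ is the set of $x\in X$ such that $x$ belongs to a transversal of $\alpha$; $\operatorname{Codom}(\alpha)$ is the set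 of $x\in X$ such that $x'$ belongs to a transversal; $\operatorname{def}(\alpha)=|X\setminus\operatorname{Dom}(\alpha)|$ and $\operatorname{codef}(\alpha)=|X\setminus\operatorname{Codom}(\alpha)|$. In a monoid $M$, an element $x$ is a left unit if $ax=1$ for some $a\in M$, and a right unit if $xb=1$ for some $b\in M$. $\mathcal G_X^L$ and $\mathcal G_X^R$ are the sets of all left units and all right units of $\mathcal{PB}_X$; $E(\mathcal{PB}_X)$ is the set of all idempotents of $\mathcal{PB}_X$; $\mathcal F_X^L=\langle E(\mathcal{PB}_X)\cup\mathcal G_X^L\rangle$ and $\mathcal F_X^R=\langle E(\mathcal{PB}_X)\cup\mathcal G_X^R\rangle$, where $\langle U\rangle$ is the subsemigroup generated by $U$. For subsets $A,B$ of a semigroup, $AB=\{ab:a\in A,\ b\in B\}$. *)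

(* Defs.v *)
From Stdlib Require Export Relation_Operators Operators_Properties.
From mathcomp Require Export all_boot.
From mathcomp Require Export boolp classical_sets functions cardinality.

Set Implicit Arguments.
Unset Strict Implicit.
Unset Printing Implicit Defensive.

Local Open Scope classical_set_scope.

Section OneSidedUnits.
Variables (T : Type) (mul : T -> T -> T) (one : T).

Definition left_units : set T := [set x | exists a, mul a x = one].

Definition right_units : set T := [set x | exists b, mul x b = one].

Definition idempotents : set T := [set e | mul e e = e].

Definition set_mul (A B : set T) : set T := [set mul a b | a in A & b in B].

Definition subsemigroup (S : set T) : Prop :=
  forall a b, S a -> S b -> S (mul a b).

Definition subsemigroup_gen (U : set T) : set T := smallest subsemigroup U.

End OneSidedUnits.

(* In X + X, [inl x] is the vertex x and [inr x] is the vertex x'. *)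
Record brauer (X : Type) := Brauer {
  edge : X + X -> X + X -> Prop;
  edge_sym : forall u v, edge u v -> edge v u;
  edge_irrefl : forall u, ~ edge u u;
  edge_deg : forall u v w, edge u v -> edge u w -> v = w }.

Section Product.
Variable X : Type.
Implicit Types (a b : brauer X) (u v w : X + X).

(* Vertices of the product graph: [inl u] is u in X \cup X', and [inr x] is
   x''. *)
Definition vertex3 : Type := (X + X) + X.

Definition rename_upper u : vertex3 :=
  match u with inl x => inl (inl x) | inr x => inr x end.

Definition rename_lower u : vertex3 :=
  match u with inl x => inr x | inr x => inl (inr x) end.

Definition renamed (f : X + X -> vertex3) a (p q : vertex3) : Prop :=
  exists u v, [/\ edge a u v, p = f u & q = f v].

Definition product_graph a b (p q : vertex3) : Prop :=
  renamed rename_upper a p q \/ renamed rename_lower b p q.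

(* As [product_graph a b] is symmetric, its reflexive transitive closure is the
   relation of lying in the same connected component. *)
Definition connected3 a b : vertex3 -> vertex3 -> Prop :=
  clos_refl_trans vertex3 (product_graph a b).

Definition mul_edge a b u v : Prop :=
  u <> v /\ connected3 a b (inl u) (inl v).

Definition factor_edge a b (c : bool) : vertex3 -> vertex3 -> Prop :=
  if c then renamed rename_upper a else renamed rename_lower b.

Lemma factor_edge_sym a b c p q : factor_edge a b c p q -> factor_edge a b c q p.
Proof. by case: c => -[u [v [/edge_sym uv -> ->]]]; exists v, u. Qed.

Lemma factor_edge_deg a b c p q r :
  factor_edge a b c p q -> factor_edge a b c p r -> q = r.
Proof.
have iu : injective rename_upper by move=> [x|x] [y|y] //= [->].
have il : injective rename_lower by move=> [x|x] [y|y] //= [->].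
case: c => -[u [v [uv -> ->]]] [u' [v' [uv' e ->]]].
- by move/iu: e uv' => <- /(edge_deg uv) ->.
- by move/il: e uv' => <- /(edge_deg uv) ->.
Qed.

Lemma factor_edge_outer a b c u p q :
  factor_edge a b c (inl u) p -> factor_edge a b (~~ c) (inl u) q -> False.
Proof.
by case: c => -[[x|x] [y [_ e _]]] [[x'|x'] [y' [_ e' _]]] //;
  move: e => /= e; move: e'; rewrite ?e.
Qed.

(* Nonempty walks whose edges come alternately from the two factors. *)
Inductive alternating a b : bool -> vertex3 -> vertex3 -> Prop :=
| alternating1 c p q : factor_edge a b c p q -> alternating a b c p q
| alternatingS c p q r : factor_edge a b c p q -> alternating a b (~~ c) q r ->
    alternating a b c p r.

Lemma alternating_inv a b c p r : alternating a b c p r ->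
  exists2 q, factor_edge a b c p q & q = r \/ alternating a b (~~ c) q r.
Proof.
by case=> {}c {}p q; [exists q => //; left|move=> {}r pq qr; exists q => //; right].
Qed.

Lemma alternating_stop a b c p u r :
  factor_edge a b c p (inl u) -> ~ alternating a b (~~ c) (inl u) r.
Proof.
by move=> /factor_edge_sym pu /alternating_inv[q /(factor_edge_outer pu)].
Qed.

Lemma alternating_deg a b c p v w :
  alternating a b c p (inl v) -> alternating a b c p (inl w) -> v = w.
Proof.
move E : (inl v : vertex3) => z pz.
elim: pz E => {c p z} [c p q pq|c p q r pq qr IH] E
  /alternating_inv[s /(factor_edge_deg pq) <-{s}].
- by rewrite -E in pq *; case=> [[]//|/(alternating_stop pq)].
- case=> [qw|]; last exact: IH.
  by rewrite qw in pq qr; case: (alternating_stop pq qr).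
Qed.

Lemma connected3_alternating a b p q :
  connected3 a b p q -> p = q \/ exists c, alternating a b c p q.
Proof.
move=> /clos_rt_rt1n_iff; elim=> {p q} [p|p q r pq _ IH].
  by left.
have {pq} [c pq] : exists c, factor_edge a b c p q.
  by case: pq => pq; [exists true|exists false].
case: IH => [<-|[d qr]]; first by right; exists c; apply: alternating1.
have [dc|/negPf dc] := eqVneq d c; last first.
  right; exists c; apply: alternatingS pq _.
  by move: qr; case: (c) (d) dc => -[].
rewrite {d}dc in qr; case/alternating_inv: qr => s.
move=> /(factor_edge_deg (factor_edge_sym pq)) <-{s} [->|pr]; first by left.
by right; exists (~~ c).
Qed.

Lemma mul_edge_sym a b u v : mul_edge a b u v -> mul_edge a b v u.
Proof.
case=> uv cuv; split; first by move=> e; apply: uv.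
elim: cuv => [p q pq|p|p q r _ qp _ rq]; last exact: rt_trans rq qp.
- apply: rt_step; case: pq => pq.
  + by left; apply: (@factor_edge_sym a b true).
  + by right; apply: (@factor_edge_sym a b false).
- exact: rt_refl.
Qed.

Lemma mul_edge_irrefl a b u : ~ mul_edge a b u u.
Proof. by case. Qed.

Lemma mul_edge_deg a b u v w : mul_edge a b u v -> mul_edge a b u w -> v = w.
Proof.
case=> uv /connected3_alternating[[]//|[c cv]].
case=> uw /connected3_alternating[[]//|[d dw]].
have [dc|/negPf dc] := eqVneq d c.
  by rewrite dc in dw; apply: alternating_deg cv dw.
have dE : d = ~~ c by case: c d dc {cv dw} => -[].
rewrite dE in dw.
have [q uq _] := alternating_inv cv; have [r ur _] := alternating_inv dw.
by case: (factor_edge_outer uq ur).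
Qed.

Definition pb_mul a b : brauer X :=
  Brauer (@mul_edge_sym a b) (@mul_edge_irrefl a b) (@mul_edge_deg a b).

Definition one_edge u v : Prop :=
  exists x, (u = inl x /\ v = inr x) \/ (u = inr x /\ v = inl x).

Lemma one_edge_sym u v : one_edge u v -> one_edge v u.
Proof. by case=> x [[-> ->]|[-> ->]]; exists x; [right|left]. Qed.

Lemma one_edge_irrefl u : ~ one_edge u u.
Proof. by case=> x [[->]|[->]]. Qed.

Lemma one_edge_deg u v w : one_edge u v -> one_edge u w -> v = w.
Proof. by move=> [x [[-> ->]|[-> ->]]] [y [[]|[]]] // [->] ->. Qed.

Definition pb_one : brauer X := Brauer one_edge_sym one_edge_irrefl one_edge_deg.

Definition Dom a : set X := [set x | exists y, edge a (inl x) (inr y)].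

Definition Codom a : set X := [set y | exists x, edge a (inl x) (inr y)].

End Product.

Arguments pb_one {X}.

(* The sets whose cardinalities are def(a) and codef(a); cardinals are compared
   through [#<=]. *)
Definition def_set (X : Type) (a : brauer X) : set X := ~` Dom a.

Definition codef_set (X : Type) (a : brauer X) : set X := ~` Codom a.

Definition E (X : Type) : set (brauer X) := idempotents (@pb_mul X).
Arguments E X : clear implicits.

Definition GL (X : Type) : set (brauer X) := left_units (@pb_mul X) pb_one.
Arguments GL X : clear implicits.

Definition GR (X : Type) : set (brauer X) := right_units (@pb_mul X) pb_one.
Arguments GR X : clear implicits.

Definition FL (X : Type) : set (brauer X) := subsemigroup_gen (@pb_mul X) (E X `|` GL X).
Arguments FL X : clear implicits.

Definition FR (X : Type) : set (brauer X) := subsemigroup_gen (@pb_mul X) (E X `|` GR X).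
Arguments FR X : clear implicits.

(* Main.v *)
Require Import Defs.
From mathcomp Require Import all_boot.
From mathcomp Require Import boolp classical_sets functions cardinality.

Set Implicit Arguments.
Unset Strict Implicit.
Unset Printing Implicit Defensive.

(** For a product [ab], call [x] inner-left when [x'] lies on a transversal of
    [a] whose upper end lies on a transversal of [ab], and inner-right when [x]
    lies on a transversal of [b] whose lower end lies on a transversal of [ab].
    Following the transversals of [ab] sends the inner-left points injectively
    to the inner-right ones, and fixes every point of both kinds, since [x'] and
    [x] are glued in the product graph.  Such a map forces the complement of the
    inner-right points to be at most as large as that of the inner-left points
    ([setC_card_le_of_inj]), however infinite the sets are; this replaces a
    count of the ends of the paths of the product graph.

    The condition [codef a <= def a] says exactly that the map from lower to
    upper ends of transversals of [a] extends to an injection [h : X -> X]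
    ([lift_transversals]).  For a product of two such elements, injections of
    this kind for [b] and [a] lead from [codef (ab)] to the complement of the
    inner-right points, then from the complement of the inner-left points to
    [def (ab)]; hence the condition defines a subsemigroup.  It contains the
    idempotents, for in [ee = e] the inner points are the codomain and the domain
    of [e], and it contains the left units, whose codomain is everything.

    Conversely, given [h], the graph [g] with edges [{h y, y'}] is a left unit,
    and [a = e g], where [e] has the upper edges of [a], the edges [{x, x'}] for
    [x] in [Dom a], and the lower edges of [a] transported along [h].  As all the
    transversals of [e] are vertical, [e] is idempotent.  So the condition, the
    product [E GL] and the generated subsemigroup define the same set.  The
    statement for right units follows by turning graphs upside down, which
    reverses products. *)

Local Open Scope classical_set_scope.
Local Open Scope card_scope.

(** * Cardinal comparison within one type *)

Lemma card_le_inj T (A B : set T) :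
  A #<= B <-> exists2 f : T -> T, set_fun A B f & set_inj A f.
Proof.
split=> [/card_leP/unsquash f|[f fAB fA]]; last first.
  have [i fE] := Pinj fA; rewrite fE in fAB.
  have [g _] := injPfun fAB.
  exact: inj_card_le g.
exists (fun x => if pselect (A x) is left Ax then val (f (SigSub (mem_set Ax)))
                 else x).
- by move=> x Ax /=; case: pselect => // Ax'; apply: set_valP.
- move=> x y /set_mem Ax /set_mem Ay /=.
  case: pselect => // Ax'; case: pselect => // Ay' /val_inj fxy.
  by have /(congr1 val) := 'inj_f (mem_setT _) (mem_setT _) fxy.
Qed.

(** An injection [A -> B] alone would not do for infinite sets: that it fixes
    the common points is what sends a point of [A] outside [B] to the complement
    of [A]. *)
Lemma setC_card_le_of_inj T (A B : set T) (t : T -> T) :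
    set_fun A B t -> set_inj A t -> (forall x, A x -> B x -> t x = x) ->
  ~` B #<= ~` A.
Proof.
move=> tAB tI tfix; apply/card_le_inj.
exists (fun x => if pselect (A x) then t x else x).
- move=> x Bx /=; case: pselect => // Ax Atx; apply: Bx.
  have tx : t x = x.
    by apply: tI; rewrite ?inE// ; apply: tfix => //; apply: tAB.
  by rewrite -tx; apply: tAB.
- move=> x y /set_mem Bx /set_mem By /=.
  case: pselect => Ax; case: pselect => Ay //=.
  + by apply: tI; rewrite inE.
  + by move=> txy; case: By; rewrite -txy; apply: tAB.
  + by move=> txy; case: Bx; rewrite txy; apply: tAB.
Qed.

(** * Subsemigroups generated by two sets *)

Lemma subsemigroup_gen_set_mul T (mul : T -> T -> T) (A B C : set T) :
    subsemigroup mul C -> A `<=` C -> B `<=` C -> C `<=` set_mul mul A B ->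
  subsemigroup_gen mul (A `|` B) = set_mul mul A B /\ set_mul mul A B = C.
Proof.
move=> mulC AC BC CAB.
have genC : subsemigroup_gen mul (A `|` B) `<=` C.
  by apply: smallest_sub => // x [/AC|/BC].
have ABgen : set_mul mul A B `<=` subsemigroup_gen mul (A `|` B).
  move=> _ [a Aa [b Bb <-]] S [mulS ABS].
  by apply: mulS; apply: ABS; [left|right].
split; apply/seteqP; split=> //.
- exact: subset_trans CAB.
- exact: subset_trans genC.
Qed.

(** * Products of Brauer graphs *)

Section Brauer.
Variable X : Type.
Implicit Types (a b c e : brauer X) (u v w : X + X) (x y z : X).

Lemma brauer_eq a b : (forall u v, edge a u v <-> edge b u v) -> a = b.
Proof.
case: a b => [r rs ri rd] [s ss si sd] /= rE.
have {}rE : r = s by apply/funext => u; apply/funext => v; apply/propext.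
by case: _ / rE ss si sd => ss si sd; congr Brauer; apply: Prop_irrelevance.
Qed.

Lemma edge_flipK a u v w : edge a u v -> edge a v w -> w = u.
Proof. by move=> /edge_sym vu /(edge_deg vu). Qed.

Lemma connected3_closed a b (S : vertex3 X -> Prop) p q :
    (forall r s, product_graph a b r s -> S r -> S s) ->
  connected3 a b p q -> S p -> S q.
Proof.
move=> Sclosed; elim=> {p q} [p q|//|p q r _ pq _ qr /pq/qr //].
exact: Sclosed.
Qed.

(** A product is computed by listing its edges and bounding the component of
    each outer vertex [u] by a set [S u] closed under adjacency. *)
Lemma pb_mul_eq a b c (S : X + X -> vertex3 X -> Prop) :
    (forall u v, edge c u v -> connected3 a b (inl u) (inl v)) ->
    (forall u, S u (inl u)) ->
    (forall u p q, product_graph a b p q -> S u p -> S u q) ->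
    (forall u v, S u (inl v) -> v = u \/ edge c u v) ->
  pb_mul a b = c.
Proof.
move=> conn S0 Sclosed Sc; apply: brauer_eq => u v; split=> /= [[uv cuv]|cuv].
- have [vu|//] := Sc u v (connected3_closed (@Sclosed u) cuv (S0 u)).
  by case: uv.
- split; last exact: conn.
  by move=> uv; rewrite uv in cuv; case: (edge_irrefl cuv).
Qed.

Lemma connected3_upper a b u v : edge a u v ->
  connected3 a b (rename_upper u) (rename_upper v).
Proof. by move=> uv; apply: rt_step; left; exists u, v. Qed.

Lemma connected3_lower a b u v : edge b u v ->
  connected3 a b (rename_lower u) (rename_lower v).
Proof. by move=> uv; apply: rt_step; right; exists u, v. Qed.

Lemma pb_mul_transversal a b x y z :
  edge a (inl x) (inr y) -> edge b (inl y) (inr z) ->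
  edge (pb_mul a b) (inl x) (inr z).
Proof.
move=> xy yz; split=> //.
exact: rt_trans (connected3_upper b xy) (connected3_lower a yz).
Qed.

(** If the edge of [a] at [x] is not a transversal, then the component of [x]
    consists of [x] and at most one other upper vertex. *)
Lemma pb_mul_Dom a b x z : edge (pb_mul a b) (inl x) (inr z) -> Dom a x.
Proof.
case=> _ cxz; apply: contrapT => ax.
suff [//|[? [//]]] : inl (inr z) = inl (inl x) :> vertex3 X \/
    exists y, inl (inr z) = inl (inl y) :> vertex3 X /\ edge a (inl x) (inl y).
apply: (connected3_closed (S := fun p => p = inl (inl x) \/
  exists y, p = inl (inl y) /\ edge a (inl x) (inl y))) cxz _ => [|]; last by left.
move=> _ _ [] [[y|y] [[w|w] [yw -> ->]]] /=; case=> [|[y' []]] // [E].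
- by right; exists w; rewrite -E.
- by move=> xy; rewrite -E in xy; left; have [->] := edge_flipK xy yw.
- by case: ax; exists w; rewrite -E.
- by move=> xy; rewrite -E in xy; have := edge_flipK xy yw.
Qed.

(** * Turning graphs upside down *)

Definition swap u : X + X :=
  match u with inl x => inr x | inr x => inl x end.

Lemma swapK : involutive swap. Proof. by case. Qed.

Definition swap3 (p : vertex3 X) : vertex3 X :=
  match p with inl u => inl (swap u) | inr x => inr x end.

Lemma swap3K : involutive swap3. Proof. by case=> [[]|]. Qed.

Lemma flip_deg a u v w :
  edge a (swap u) (swap v) -> edge a (swap u) (swap w) -> v = w.
Proof. by move=> uv /(edge_deg uv)/(can_inj swapK). Qed.

Definition flip a : brauer X :=
  @Brauer X (fun u v => edge a (swap u) (swap v))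
    (fun u v uv => edge_sym uv) (fun u => @edge_irrefl X a (swap u))
    (@flip_deg a).

Lemma flipK : involutive flip.
Proof. by move=> a; apply: brauer_eq => u v /=; rewrite !swapK. Qed.

Lemma connected3_flip a b p q : connected3 a b p q ->
  connected3 (flip b) (flip a) (swap3 p) (swap3 q).
Proof.
elim=> {p q} [p q pq|p|p q r _ pq _ qr]; last exact: rt_trans pq qr.
- apply: rt_step; case: pq => -[u [v [uv -> ->]]]; [right|left];
    exists (swap u), (swap v); rewrite /= !swapK; split=> //.
  + by case: (u).
  + by case: (v).
  + by case: (u).
  + by case: (v).
- exact: rt_refl.
Qed.

Lemma flip_pb_mul a b : flip (pb_mul a b) = pb_mul (flip b) (flip a).
Proof.
apply: brauer_eq => u v; split=> -[uv cuv]; split.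
- by move=> E; apply: uv; rewrite E.
- by have := connected3_flip cuv; rewrite /= !swapK.
- by move=> /(can_inj swapK).
- by have := connected3_flip cuv; rewrite !flipK.
Qed.

Lemma flip_pb_one : flip pb_one = pb_one.
Proof.
by apply: brauer_eq => -[x|x] [y|y]; split=> -[z [[]|[]]] //= [->] [->];
  exists z; by [left|right].
Qed.

Lemma edge_flip a x y :
  edge (flip a) (inl x) (inr y) <-> edge a (inl y) (inr x).
Proof. by split=> /edge_sym. Qed.

Lemma Codom_flip a : Codom (flip a) = Dom a.
Proof.
by apply/seteqP; split=> y [x xy]; exists x; apply/edge_sym.
Qed.

Lemma Dom_flip a : Dom (flip a) = Codom a.
Proof. by rewrite -Codom_flip flipK. Qed.

Lemma codef_set_flip a : codef_set (flip a) = def_set a.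
Proof. by rewrite /codef_set Codom_flip. Qed.

Lemma def_set_flip a : def_set (flip a) = codef_set a.
Proof. by rewrite /def_set Dom_flip. Qed.

Lemma pb_mul_Codom a b x z : edge (pb_mul a b) (inl x) (inr z) -> Codom b z.
Proof.
by rewrite -edge_flip flip_pb_mul => /pb_mul_Dom; rewrite Dom_flip.
Qed.

Lemma E_flip a : E X a -> E X (flip a).
Proof. by rewrite /E /idempotents /= -flip_pb_mul => ->. Qed.

Lemma GR_flip a : GR X a -> GL X (flip a).
Proof. by case=> b ab; exists (flip b); rewrite -flip_pb_mul ab flip_pb_one. Qed.

Lemma GL_flip a : GL X a -> GR X (flip a).
Proof. by case=> b ba; exists (flip b); rewrite -flip_pb_mul ba flip_pb_one. Qed.

(** * The condition codef <= def is multiplicative *)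

Definition inner_left a b : set X := [set x | exists (u v : X),
  edge a (inl u) (inr x) /\ edge (pb_mul a b) (inl u) (inr v)].

Definition inner_right a b : set X := [set x | exists (u v : X),
  edge b (inl x) (inr v) /\ edge (pb_mul a b) (inl u) (inr v)].

Lemma setC_inner_card_le a b : ~` inner_right a b #<= ~` inner_left a b.
Proof.
pose R x y := exists (u v : X), [/\ edge a (inl u) (inr x), edge b (inl y) (inr v) &
  edge (pb_mul a b) (inl u) (inr v)].
have /choice[t tP] x : exists y, inner_left a b x -> R x y.
  have [[u [v [ux uv]]]|nx] := pselect (inner_left a b x); last by exists x.
  by have [y yv] := pb_mul_Codom uv; exists y => _; exists u, v.
apply: (@setC_card_le_of_inj _ _ _ t).
- by move=> x /tP[u [v [_ yv uv]]]; exists u, v.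
- move=> x y /set_mem/tP[u [v [ux xv uv]]] /set_mem/tP[u' [v' [uy yv uv']]] txy.
  rewrite txy in xv; have [vv'] := edge_deg xv yv.
  rewrite vv' in uv; have [uu'] := edge_deg (edge_sym uv) (edge_sym uv').
  by rewrite uu' in ux; have [] := edge_deg ux uy.
- move=> x /tP[u [v [ux tv uv]]] [u' [v' [xv' _]]].
  have [vv'] := edge_deg uv (pb_mul_transversal ux xv').
  by rewrite -vv' in xv'; have [] := edge_deg (edge_sym tv) (edge_sym xv').
Qed.

Lemma idempotent_codef_def e : E X e -> codef_set e #<= def_set e.
Proof.
(* As [e] is idempotent, the two sets of inner points of [flip e] are [Dom e], on the
   left, and [Codom e], on the right. *)
move=> /E_flip ee; have := setC_inner_card_le (flip e) (flip e).
rewrite -(codef_set_flip e) -(def_set_flip e) /codef_set /def_set.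
move: (flip e) ee => {}e ee.
have -> : inner_left e e = Codom e.
  apply/seteqP; split=> x [u]; first by case=> v [ux _]; exists u.
  by move=> ux; exists u, x; split=> //; rewrite ee.
have -> // : inner_right e e = Dom e.
apply/seteqP; split=> x [u]; first by case=> v [xv _]; exists v.
by move=> xu; exists x, u; split=> //; rewrite ee.
Qed.

(** No information is lost here: the values of [h] on [Codom a] exhaust [Dom a],
    so [h] restricts to an injection from [codef_set a] to [def_set a]. *)
Lemma lift_transversals a : codef_set a #<= def_set a ->
  exists2 h : X -> X, injective h & forall x y, edge a (inl x) (inr y) -> x = h y.
Proof.
move=> /card_le_inj[f fdef finj].
have /choice[h hP] y : exists x,
    edge a (inl x) (inr y) \/ codef_set a y /\ x = f y.
  have [[x xy]|ny] := pselect (Codom a y); first by exists x; left.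
  by exists (f y); right.
exists h => [y z|x y xy].
- case: (hP y) (hP z) => [hy|[ay ->]] [hz|[az ->]] E.
  + by rewrite E in hy; have [] := edge_deg hy hz.
  + by case: (fdef _ az); exists y; rewrite -E.
  + by case: (fdef _ ay); exists z; rewrite E.
  + by apply: finj => //; rewrite inE.
- have [hy|[ay _]] := hP y; last by case: ay; exists x.
  by have [] := edge_deg (edge_sym xy) (edge_sym hy).
Qed.

Lemma pb_mul_codef_def a b :
    codef_set a #<= def_set a -> codef_set b #<= def_set b ->
  codef_set (pb_mul a b) #<= def_set (pb_mul a b).
Proof.
move=> /lift_transversals[ha haI haE] /lift_transversals[hb hbI hbE].
have codef_inner : codef_set (pb_mul a b) #<= ~` inner_right a b.
  apply/card_le_inj; exists hb => [y ny [u [v [/hbE/hbI <- uv]]]|y z _ _ /hbI//].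
  by apply: ny; exists u.
have inner_def : ~` inner_left a b #<= def_set (pb_mul a b).
  apply/card_le_inj; exists ha => [z nz [v uv]|y z _ _ /haI//].
  have [x ux] := pb_mul_Dom uv; have zx := haI _ _ (haE _ _ ux).
  by apply: nz; exists (ha z), v; rewrite {2}zx.
exact: card_le_trans codef_inner
  (card_le_trans (setC_inner_card_le a b) inner_def).
Qed.

Lemma left_unit_codef_def a : GL X a -> codef_set a #<= def_set a.
Proof.
case=> b ba; suff -> : codef_set a = set0 by exact: card_ge0.
apply/seteqP; split=> // x; apply.
by apply: (@pb_mul_Codom b a x); rewrite ba; exists x; left.
Qed.

(** * Factorisation into an idempotent and a left unit *)

Section GraphOfInjection.
Variables (h : X -> X) (hI : injective h).

Definition graph_edge u v : Prop :=
  exists y, (u = inl (h y) /\ v = inr y) \/ (u = inr y /\ v = inl (h y)).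

Lemma graph_edge_sym u v : graph_edge u v -> graph_edge v u.
Proof. by case=> y [[-> ->]|[-> ->]]; exists y; [right|left]. Qed.

Lemma graph_edge_irrefl u : ~ graph_edge u u.
Proof. by case=> y [[->]|[->]]. Qed.

Lemma graph_edge_deg u v w : graph_edge u v -> graph_edge u w -> v = w.
Proof.
move=> [y [[-> ->]|[-> ->]]] [z [[]|[]]] //.
- by case=> /hI -> ->.
- by case=> -> ->.
Qed.

Definition graph_of_inj : brauer X :=
  Brauer graph_edge_sym graph_edge_irrefl graph_edge_deg.

Lemma graph_of_inj_left_unit : GL X graph_of_inj.
Proof.
exists (flip graph_of_inj).
pose S u (p : vertex3 X) :=
  let y := match u with inl y => y | inr y => y end in
  match p with inl (inl z) => z = y | inl (inr z) => z = y | inr x => x = h y end.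
have through y : connected3 (flip graph_of_inj) graph_of_inj
    (inl (inl y)) (inl (inr y)).
  have yh : edge (flip graph_of_inj) (inl y) (inr (h y)) by exists y; right.
  have hy : edge graph_of_inj (inl (h y)) (inr y) by exists y; left.
  exact: rt_trans (connected3_upper _ yh) (connected3_lower _ hy).
apply: (@pb_mul_eq _ _ _ S).
- move=> u v [y [[-> ->]|[-> ->]]]; first exact: through.
  have yy : edge (pb_mul (flip graph_of_inj) graph_of_inj) (inl y) (inr y).
    by split.
  by case: (edge_sym yy).
- by case.
- move=> u p q pq; rewrite /S; move: (match u with inl y => y | inr y => y end).
  case: pq => -[[x|x] [[y|y] [xy -> ->]]] z /=;
    case: xy => w [[]|[]] //= [->] [->]; solve [by move=> ->|by move=> /hI].
- case=> y [] z /= ->;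
    solve [by left|by right; exists y; left|by right; exists y; right].
Qed.

End GraphOfInjection.

(** A middle vertex [x''] can only be entered from [x] or from [x'], through a
    vertical edge; the other of the two is then its other neighbour.  So walks
    cross the middle row vertically, and [ee] has no edges beyond those of [e]. *)
Lemma vertical_idempotent e :
  (forall x y, edge e (inl x) (inr y) -> x = y) -> E X e.
Proof.
move=> vert.
pose S0 u v := v = u \/ edge e u v.
have S0e u v w : S0 u v -> edge e v w -> S0 u w.
  by move=> [->|uv]; [right|left; apply: edge_flipK uv _].
pose S u (p : vertex3 X) := match p with
  | inl v => S0 u v
  | inr x => edge e (inl x) (inr x) /\ S0 u (inl x)
  end.
apply: (@pb_mul_eq _ _ _ S).
- move=> [x|x] [y|y] xy.
  + exact: (connected3_upper e xy).
  + have E := vert _ _ xy; rewrite -E in xy *.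
    exact: rt_trans (connected3_upper e xy) (connected3_lower e xy).
  + have yx := edge_sym xy; have E := vert _ _ yx; rewrite -E in xy *.
    exact: rt_trans (connected3_lower e xy) (connected3_upper e xy).
  + exact: (connected3_lower e xy).
- by move=> u; left.
- move=> u p q; case=> -[[x|x] [[y|y] [xy -> ->]]] /=.
  + by move=> ux; apply: S0e xy.
  + by move=> ux; have E := vert _ _ xy; rewrite -E in xy *.
  + by case=> xx ux; have yx := edge_sym xy; rewrite (vert _ _ yx).
  + by case=> /edge_sym xx _; have := edge_deg xx xy.
  + by case=> xx _; have := edge_deg xx xy.
  + by case=> xx ux; apply: S0e xy.
  + move=> ux; have yx := edge_sym xy.
    have E := vert _ _ yx; rewrite E in xy yx *; split=> //.
    exact: S0e xy.
  + by move=> ux; apply: S0e xy.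
- by [].
Qed.

Section Factorisation.
Variables (a : brauer X) (h : X -> X) (hI : injective h).
Hypothesis hE : forall x y, edge a (inl x) (inr y) -> x = h y.

Definition left_factor_edge u v : Prop :=
  match u, v with
  | inl x, inl y => edge a (inl x) (inl y)
  | inl x, inr y => x = y /\ Dom a x
  | inr x, inl y => x = y /\ Dom a x
  | inr x, inr y => exists x0 y0, [/\ x = h x0, y = h y0 & edge a (inr x0) (inr y0)]
  end.

Lemma left_factor_edge_sym u v : left_factor_edge u v -> left_factor_edge v u.
Proof.
case: u v => [x|x] [y|y] /=; first exact: edge_sym.
- by case=> ->.
- by case=> ->.
- by case=> x0 [y0 [-> -> /edge_sym yx]]; exists y0, x0.
Qed.

Lemma left_factor_edge_irrefl u : ~ left_factor_edge u u.
Proof.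
case: u => [x|x] /=; first exact: edge_irrefl.
by case=> y [z [-> /hI <-]]; apply: edge_irrefl.
Qed.

Lemma Dom_lift x y : Dom a x -> x = h y -> edge a (inl x) (inr y).
Proof. by case=> z xz xy; have := hE xz; rewrite {1}xy => /hI ->. Qed.

Lemma left_factor_edge_deg u v w :
  left_factor_edge u v -> left_factor_edge u w -> v = w.
Proof.
case: u => x; case: v => y; case: w => z /=.
- exact: edge_deg.
- by move=> xy [_ [t xt]]; have := edge_deg xy xt.
- by move=> [_ [t xt]] xz; have := edge_deg xt xz.
- by case=> <- _ [<-].
- by case=> <- _ [<-].
- move=> [_ Dx] [x0 [z0 [/(Dom_lift Dx)/edge_sym xx _]]].
  by move/(edge_deg xx).
- move=> [x0 [z0 [xE _ xz]]] [_ /Dom_lift/(_ xE)/edge_sym xx].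
  by have := edge_deg xx xz.
- case=> x0 [y0 [-> -> xy]] [x1 [z0 [/hI E -> xz]]].
  by rewrite -E in xz; have [->] := edge_deg xy xz.
Qed.

Definition left_factor : brauer X :=
  Brauer left_factor_edge_sym left_factor_edge_irrefl left_factor_edge_deg.

Lemma left_factor_idempotent : E X left_factor.
Proof. by apply: vertical_idempotent => x y []. Qed.

Lemma left_factor_mul : pb_mul left_factor (graph_of_inj hI) = a.
Proof.
pose g := graph_of_inj hI.
pose S0 u v := v = u \/ edge a u v.
have S0e u v w : S0 u v -> edge a v w -> S0 u w.
  by move=> [->|uv]; [right|left; apply: edge_flipK uv _].
(* In [g] the middle vertex (h y)'' is joined to y', so the two lie in the same
   components. *)
pose S u (p : vertex3 X) := match p with
  | inl v => S0 u v
  | inr x => exists2 y, x = h y & S0 u (inr y)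
  end.
have hy y : edge g (inl (h y)) (inr y) by exists y; left.
have yh y : edge g (inr y) (inl (h y)) by exists y; right.
apply: (@pb_mul_eq _ _ _ S).
- move=> [x|x] [y|y] xy.
  + by apply: (@connected3_upper left_factor g (inl x) (inl y)).
  + have ex : edge left_factor (inl x) (inr x) by split=> //; exists y.
    apply: rt_trans (connected3_upper g ex) _; rewrite (hE xy).
    exact: connected3_lower (hy y).
  + apply: rt_trans (connected3_lower left_factor (yh x)) _.
    have yx := edge_sym xy; rewrite (hE yx).
    apply: (@connected3_upper left_factor g (inr (h x)) (inl (h x))).
    by split=> //; exists x; rewrite -(hE yx).
  + apply: rt_trans (connected3_lower left_factor (yh x)) _.
    apply: rt_trans (connected3_lower left_factor (hy y)).
    apply: (@connected3_upper left_factor g (inr (h x)) (inr (h y))).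
    by exists x, y.
- by move=> u; left.
- move=> u p q; case=> -[[x|x] [[y|y] [xy -> ->]]] /=.
  + by move=> ux; apply: S0e xy.
  + case: xy => <- [z xz] ux; exists z; first exact: hE.
    exact: S0e xz.
  + case: xy => <- Dx [z xz uz]; apply: S0e uz _.
    exact/edge_sym/Dom_lift.
  + case: xy => x0 [y0 [-> -> xy]] [z /hI <- ux]; exists y0 => //.
    exact: S0e xy.
  + by case: xy => z [[]|[]].
  + by case: xy => z [[]|[]] // [->] [->] [t /hI <-].
  + by case: xy => z [[]|[]] // [->] [->]; exists z.
  + by case: xy => z [[]|[]].
- by [].
Qed.

End Factorisation.

Lemma codef_def_factor a : codef_set a #<= def_set a ->
  set_mul (@pb_mul X) (E X) (GL X) a.
Proof.
move=> /lift_transversals[h hI hE].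
exists (left_factor hI hE); first exact: left_factor_idempotent.
exists (graph_of_inj hI); first exact: graph_of_inj_left_unit.
exact: left_factor_mul.
Qed.

End Brauer.

Theorem theorem6p6 (X : Type) :
  (FL X = set_mul (@pb_mul X) (E X) (GL X) /\
   set_mul (@pb_mul X) (E X) (GL X) =
     [set a : brauer X | codef_set a #<= def_set a]) /\
  (FR X = set_mul (@pb_mul X) (GR X) (E X) /\
   set_mul (@pb_mul X) (GR X) (E X) =
     [set a : brauer X | def_set a #<= codef_set a]).
Proof.
split; rewrite /FL /FR; last rewrite setUC; apply: subsemigroup_gen_set_mul => /=.
- exact: pb_mul_codef_def.
- exact: idempotent_codef_def.
- exact: left_unit_codef_def.
- exact: codef_def_factor.
- move=> a b /= da db; have := @pb_mul_codef_def _ (flip b) (flip a).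
  by rewrite -flip_pb_mul !codef_set_flip !def_set_flip; apply.
- move=> a /GR_flip/left_unit_codef_def /=.
  by rewrite codef_set_flip def_set_flip.
- move=> a /E_flip/idempotent_codef_def /=.
  by rewrite codef_set_flip def_set_flip.
- move=> a /= da; have := @codef_def_factor _ (flip a).
  rewrite codef_set_flip def_set_flip => /(_ da)[e Ee [g Gg ega]].
  exists (flip g); first exact: GL_flip.
  exists (flip e); first exact: E_flip.
  by rewrite -flip_pb_mul ega flipK.
Qed.
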